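(* Let $X\subset\mathbb{CP}^N$ be a projective algebraic surface of degree $8$ admitting a projective degeneration into a union of $8$ planes whose shadow is the complex $X^1$ described in the context, and let $X_{\mathrm{Gal}}$ be the Galois cover of $X$ with respect to a generic projection $X\to\mathbb{CP}^2$. Then the fundamental group $\pi_1(X_{\mathrm{Gal}})$ is trivial.
   Context: **Degeneration and shadow.** A generic projection $p':X_0\to\mathbb{CP}^2$ is a projective degeneration of a generic projection $p:Y\to\mathbb{CP}^2$ if there are a flat family $\pi:V\to\Delta$ over the unit disc and a map $F:V\to\Delta\times\mathbb{CP}^2$ (called an embedding in the source) whose composition with the first projection is $\pi$, such that $\pi^{-1}(0)\simeq X_0$, $\pi^{-1}(t_0)\simeq Y$ for some $t_0\neq0$, the family is smooth over $\Delta\setminus\{0\}$, and $F$ restricts to $0\times p'$ on $\pi^{-1}(0)$ and to $t_0\times p$ on $\pi^{-1}(t_0)$. Here the degenerate fibre is a union of planes ($\cong\mathbb{CP}^2$), with only two planes meeting along any line. The shadow of the degeneration is the 2-dimensional complex with one triangle for each plane; two triangles share an edge (resp. a vertex) if the corresponding planes meet in a line (resp. a point). An edge belonging to a single triangle is redundant; only non-redundant edges are numbered $1,\dots,q$. The multiplicity of a vertex is the number of non-redundant edges at it. **Shadow $X^1$.** Vertices $V_1,\dots,V_8$; triangles $V_1V_5V_3$, $V_1V_3V_4$, $V_1V_4V_6$, $V_1V_6V_5$, $V_2V_3V_4$, $V_2V_3V_8$, $V_2V_8V_7$, $V_2V_7V_4$. The $q=9$ non-redundant edges are $1=V_1V_5$,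 $2=V_1V_3$, $3=V_1V_6$, $4=V_1V_4$, $5=V_3V_4$, $6=V_2V_4$, $7=V_2V_3$, $8=V_2V_7$, $9=V_2V_8$. **Galois cover.** For a generic projection $f:X\to\mathbb{CP}^2$ of degree $n$ (here $n=8$), $X_{\mathrm{Gal}}=\overline{(X\times_{\mathbb{CP}^2}\cdots\times_{\mathbb{CP}^2}X)\setminus\triangle}$ ($n$ factors), where $\triangle$ is the extended diagonal $\{(x_1,\dots,x_n): x_i=x_j \text{ for some } i\ne j\}$. Let $S\subset\mathbb{CP}^2$ be the branch curve of $f$ and $G=\pi_1(\mathbb{CP}^2\setminus S)$. The group $G$ is generated by $\gamma_i,\gamma_{i'}$ ($1\le i\le q$). There is an exact sequence $$1\to\pi_1(X_{\mathrm{Gal}})\to G/\langle\langle\gamma^2\rangle\rangle\to S_n\to1,$$ where $\langle\langle\gamma^2\rangle\rangle$ is the normal subgroup generated by all $\gamma_i^2,\gamma_{i'}^2$, and $\gamma_i,\gamma_{i'}$ both map to the transposition exchanging the two triangles that share edge $i$. **Presentation of $G$ (the standard Van Kampen presentation from the regeneration technique).** Write $[x,y]=xyx^{-1}y^{-1}$ and $\langle x,y\rangle=xyxy^{-1}x^{-1}y^{-1}$. The group $G$ is presented on the generators above with the following relations. (R4) For each $(i,j,k,l)\in\{(1,2,3,4),(6,7,8,9)\}$, writing $a,a',b,b',c,c',d,d'$ for $\gamma_i,\gamma_{i'},\gamma_j,\gamma_{j'},\gamma_k,\gamma_{k'},\gamma_l,\gamma_{l'}$: - $\langle a',b\rangle=\langle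 a',b'\rangle=\langle a',b^{-1}b'b\rangle=e$; - $\langle c,d\rangle=\langle c',d\rangle=\langle c^{-1}c'c,d\rangle=e$; - $[b'ba'b^{-1}b'^{-1},d]=e$; - $[b'ba'b^{-1}b'^{-1},c^{-1}c'^{-1}d^{-1}d'dc'c]=e$; - $\langle a,b\rangle=\langle a,b'\rangle=\langle a,b^{-1}b'b\rangle=e$; - $\langle c,d^{-1}d'd\rangle=\langle c',d^{-1}d'd\rangle=\langle c^{-1}c'c,d^{-1}d'd\rangle=e$; - $[b'bab^{-1}b'^{-1},d^{-1}d'd]=e$; - $[b'bab^{-1}b'^{-1},c^{-1}c'^{-1}d^{-1}d'^{-1}dd'dc'c]=e$; - $b'ba'ba'^{-1}b^{-1}b'^{-1}=dc'd^{-1}$; - $b'ba'b'a'^{-1}b^{-1}b'^{-1}=dc'cc'^{-1}d^{-1}$; - $b'baba^{-1}b^{-1}b'^{-1}=d^{-1}d'dc'd^{-1}d'^{-1}d$; - $b'bab'a^{-1}b^{-1}b'^{-1}=d^{-1}d'dc'cc'^{-1}d^{-1}d'^{-1}d$. (R3) For each $(i,j,k)\in\{(2,5,7),(4,5,6)\}$, writing $a,a',b,b',c,c'$ for $\gamma_i,\gamma_{i'},\gamma_j,\gamma_{j'},\gamma_k,\gamma_{k'}$: - $\langle a',b\rangle=\langle a',b'\rangle=\langle a',b^{-1}b'b\rangle=e$; - $a=b'ba'b^{-1}b'^{-1}$; - $\langle c,b'ba'ba'^{-1}b^{-1}b'^{-1}\rangle=\langle c,b'ba'b'a'^{-1}b^{-1}b'^{-1}\rangle=\langle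 c,b'ba'b^{-1}b'ba'^{-1}b^{-1}b'^{-1}\rangle=e$; - $c'=c\,b'ba'b'ba'^{-1}b^{-1}b'^{-1}\,c\,b'ba'b^{-1}b'^{-1}a'^{-1}b^{-1}b'^{-1}\,c^{-1}$; - $[a,c]=[a,c']=[a',c]=[a',c']=e$. (R1) $\gamma_i=\gamma_{i'}$ for $i=1,3,8,9$. (R5) $[x,y]=e$ for all $x\in\{\gamma_i,\gamma_{i'}\}$, $y\in\{\gamma_j,\gamma_{j'}\}$, whenever edges $i,j$ have no common vertex, i.e. $(i,j)\in(\{1,3\}\times\{5,6,7,8,9\})\cup(\{2\}\times\{6,8,9\})\cup(\{4\}\times\{7,8,9\})\cup(\{5\}\times\{8,9\})$. (RP) $\gamma_{9'}\gamma_9\gamma_{8'}\gamma_8\cdots\gamma_{1'}\gamma_1=e$. *)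

(* Defs.v *)
From HB Require Import structures.
From mathcomp Require mpoly.
Import -(notations) mpoly.
From mathcomp Require Import all_boot all_order all_algebra all_fingroup.
From mathcomp Require Import all_classical all_reals all_analysis.
From mathcomp Require Import complex ring lra.

Set Implicit Arguments.
Unset Strict Implicit.
Unset Printing Implicit Defensive.

Import Order.TTheory GRing.Theory Num.Theory.
Import numFieldNormedType.Exports.

Local Open Scope classical_set_scope.
Local Open Scope ring_scope.
Local Open Scope quotient_scope.

(* A pregroup satisfies the group axioms up to a congruence; pquot is the
   group of congruence classes. *)
Record pregroup := Pregroup {
  psort :> Type;
  peq : psort -> psort -> Prop;
  pmul : psort -> psort -> psort;
  pone : psort;
  pinv : psort -> psort;
  peq_refl : forall x, peq x x;
  peq_sym : forall x y, peq x y -> peq y x;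
  peq_trans : forall x y z, peq x y -> peq y z -> peq x z;
  pmul_cong : forall x x' y y', peq x x' -> peq y y' ->
    peq (pmul x y) (pmul x' y');
  pinv_cong : forall x x', peq x x' -> peq (pinv x) (pinv x');
  pmulA : forall x y z, peq (pmul x (pmul y z)) (pmul (pmul x y) z);
  pmul1l : forall x, peq (pmul pone x) x;
  pmul1r : forall x, peq (pmul x pone) x;
  pmulVl : forall x, peq (pmul (pinv x) x) pone;
  pmulVr : forall x, peq (pmul x (pinv x)) pone }.

Section PregroupQuotient.
Variable P : pregroup.

Definition prel : rel {classic P} := fun x y => `[< peq (x : P) (y : P) >].

Lemma prel_refl : reflexive prel.
Proof. by move=> x; apply/asboolP; exact: peq_refl. Qed.

Lemma prel_sym : symmetric prel.
Proof. by move=> x y; apply/asboolP/asboolP; exact: peq_sym. Qed.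

Lemma prel_trans : transitive prel.
Proof.
by move=> y x z /asboolP xy /asboolP yz; apply/asboolP/(peq_trans xy yz).
Qed.

Canonical prel_equiv := EquivRel prel prel_refl prel_sym prel_trans.

Definition pquot : Type := {eq_quot prel_equiv}.
HB.instance Definition _ := Choice.on pquot.
HB.instance Definition _ := Quotient.on pquot.

Definition pcls (x : P) : pquot := \pi_pquot (x : {classic P}).

Lemma pclsP (x y : P) : pcls x = pcls y <-> peq x y.
Proof. by split=> [/eqquotP/asboolP|xy]; last exact/eqquotP/asboolP. Qed.

Definition prep (q : pquot) : P := generic_quotient.repr q.

Lemma prepK q : pcls (prep q) = q.
Proof. exact: reprK. Qed.

Definition pquot_mul (p q : pquot) := pcls (pmul (prep p) (prep q)).
Definition pquot_inv (p : pquot) := pcls (pinv (prep p)).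

Lemma pcls_mul x y : pquot_mul (pcls x) (pcls y) = pcls (pmul x y).
Proof. by apply/pclsP/pmul_cong; apply/pclsP; rewrite prepK. Qed.

Lemma pcls_inv x : pquot_inv (pcls x) = pcls (pinv x).
Proof. by apply/pclsP/pinv_cong; apply/pclsP; rewrite prepK. Qed.

Lemma pquot_mulA : associative pquot_mul.
Proof.
move=> p q r; rewrite -(prepK p) -(prepK q) -(prepK r) !pcls_mul.
by apply/pclsP/pmulA.
Qed.

Lemma pquot_mul1l : left_id (pcls (pone P)) pquot_mul.
Proof. by move=> p; rewrite -(prepK p) pcls_mul; apply/pclsP/pmul1l. Qed.

Lemma pquot_mul1r : right_id (pcls (pone P)) pquot_mul.
Proof. by move=> p; rewrite -(prepK p) pcls_mul; apply/pclsP/pmul1r. Qed.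

Lemma pquot_mulVl : left_inverse (pcls (pone P)) pquot_inv pquot_mul.
Proof.
by move=> p; rewrite -(prepK p) pcls_inv pcls_mul; apply/pclsP/pmulVl.
Qed.

Lemma pquot_mulVr : right_inverse (pcls (pone P)) pquot_inv pquot_mul.
Proof.
by move=> p; rewrite -(prepK p) pcls_inv pcls_mul; apply/pclsP/pmulVr.
Qed.

HB.instance Definition _ := isGroup.Build pquot pquot_mulA pquot_mul1l
  pquot_mul1r pquot_mulVl pquot_mulVr.

Lemma pclsM x y : pcls (pmul x y) = (pcls x * pcls y)%g.
Proof. by rewrite -pcls_mul. Qed.

Lemma pclsV x : pcls (pinv x) = (pcls x)^-1%g.
Proof. by rewrite -pcls_inv. Qed.

Lemma pcls1 : pcls (pone P) = 1%g.
Proof. by []. Qed.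
End PregroupQuotient.

Section FundamentalGroup.
Variables (R : realType) (X : topologicalType) (x0 : X).

Record loop := Loop {
  loop_fun :> R -> X;
  loop_cont : {within `[0, 1], continuous loop_fun};
  loop_start : loop_fun 0 = x0;
  loop_end : loop_fun 1 = x0 }.
Arguments loop_cont : clear implicits.

Definition homotopic (f g : loop) := exists H : R * R -> X,
  [/\ {within `[0, 1] `*` `[0, 1], continuous H},
      forall t, t \in `[0, 1] -> H (0, t) = f t /\ H (1, t) = g t &
      forall s, s \in `[0, 1] -> H (s, 0) = x0 /\ H (s, 1) = x0].

Lemma within_comp (U V W : topologicalType) (A : set U) (B : set V)
    (phi : U -> V) (f : V -> W) : continuous phi ->
  (forall u, A u -> B (phi u)) -> {within B, continuous f} ->
  {within A, continuous (f \o phi)}.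
Proof.
move=> cphi AB /subspace_continuousP cf; apply/subspace_continuousP => u Au.
apply: cvg_trans (cf _ (AB _ Au)) => S /= fS.
rewrite /nbhs /= in fS.
have := cphi u _ fS; rewrite !nbhs_simpl /= => h.
by apply: filterS h => v /= h Av; apply: h; exact: AB.
Qed.

Arguments within_comp {U V W} A B phi f _ _ _.

Lemma within_eq (U W : topologicalType) (A : set U) (f g : U -> W) :
  (forall u, A u -> f u = g u) -> {within A, continuous f} ->
  {within A, continuous g}.
Proof.
by move=> fg; apply: subspace_eq_continuous => u; rewrite inE; exact: fg.
Qed.

Arguments within_eq {U W} A f g _ _.

Lemma within_glue (U W : topologicalType) (D : set U) (c : U -> R) (a : R)
    (f g : U -> W) : closed D -> continuous c ->
  {within [set u | D u /\ c u <= a], continuous f} ->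
  {within [set u | D u /\ a <= c u], continuous g} ->
  (forall u, D u -> c u = a -> f u = g u) ->
  {within D, continuous (fun u => if c u <= a then f u else g u)}.
Proof.
move=> cD cc cf cg fg.
have -> : D = [set u | D u /\ c u <= a] `|` [set u | D u /\ a <= c u].
  apply/seteqP; split=> [u Du|u [[]|[]] //].
  by case/orP: (le_total (c u) a) => h; [left|right].
apply: withinU_continuous.
- apply: closedI => //; apply: (@preimage_closed _ _ c [set x | x <= a]).
    by move=> u _; exact: cc.
  exact: closed_le.
- apply: closedI => //; apply: (@preimage_closed _ _ c [set x | a <= x]).
    by move=> u _; exact: cc.
  exact: closed_ge.
- by apply: within_eq cf => u [_ ->].
- apply: within_eq cg => u [Du ua]; case: ifP => // ua'.
  by apply/esym/fg => //; apply/eqP; rewrite eq_le ua ua'.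
Qed.

Arguments within_glue {U W} D c a f g _ _ _ _ _.

Lemma fst_cont (U V : topologicalType) : continuous (@fst U V).
Proof. by move=> x; exact: cvg_fst. Qed.
Lemma snd_cont (U V : topologicalType) : continuous (@snd U V).
Proof. by move=> x; exact: cvg_snd. Qed.

Lemma pair_cont (T U V : topologicalType) (f : T -> U) (g : T -> V) :
  continuous f -> continuous g -> continuous (fun x => (f x, g x)).
Proof. by move=> cf cg x; apply: cvg_pair; [exact: cf|exact: cg]. Qed.

Lemma addr_cont (T : topologicalType) (f g : T -> R) :
  continuous f -> continuous g -> continuous (fun x => f x + g x).
Proof. by move=> cf cg x; apply: cvgD; [exact: cf|exact: cg]. Qed.

Lemma mulr_cont (T : topologicalType) (f g : T -> R) :
  continuous f -> continuous g -> continuous (fun x => f x * g x).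
Proof. by move=> cf cg x; apply: cvgM; [exact: cf|exact: cg]. Qed.

Lemma oppr_cont (T : topologicalType) (f : T -> R) :
  continuous f -> continuous (fun x => - f x).
Proof. by move=> cf x; apply: cvgN; exact: cf. Qed.

Lemma cst_cont (T U : topologicalType) (c : U) : continuous (fun _ : T => c).
Proof. by move=> x; exact: cvg_cst. Qed.

Lemma id_cont (T : topologicalType) : continuous (fun x : T => x).
Proof. by move=> x; exact: cvg_id. Qed.

Ltac cont := do ?[exact: fst_cont|exact: snd_cont|exact: cst_cont|exact: id_cont
  |apply: pair_cont|apply: addr_cont|apply: mulr_cont|apply: oppr_cont].

Let I2 : set (R * R) := `[0, 1] `*` `[0, 1].
Let closed_I : closed (`[0 : R, 1] : set R).
Proof. exact: itv_closed. Qed.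
Let closed_I2 : closed I2.
Proof.
have -> : I2 = fst @^-1` (`[0 : R, 1] : set R) `&`
    snd @^-1` (`[0 : R, 1] : set R).
  by apply/seteqP; split.
apply: closedI; apply: preimage_closed => // u _.
  exact: fst_cont.
exact: snd_cont.
Qed.

Local Notation Im := (`[0 : R, 1]%classic : set R).

Lemma mem01 (t : R) : Im t <-> 0 <= t /\ t <= 1.
Proof. by rewrite /= in_itv /=; split=> [/andP[]|[-> ->]]. Qed.

Lemma const_homotopy_refl f : homotopic f f.
Proof.
exists (f \o snd); split=> [|//|s _ /=]; last by rewrite loop_start loop_end.
apply: (within_comp _ Im snd f _ _ (loop_cont f)) => [|[a b] []//].
exact: snd_cont.
Qed.

Lemma homotopic_sym f g : homotopic f g -> homotopic g f.
Proof.
case=> H [cH fg ends]; exists (H \o (fun u => (1 - u.1, u.2))); split.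
- apply: (within_comp _ I2 _ H _ _ cH) => [|[a b] [/= /mem01[a0 a1] ?]].
    by cont.
  by split=> //=; apply/mem01; split; lra.
- by move=> t /fg[H0 H1] /=; rewrite subr0 subrr.
- move=> s s01 /=; apply: ends.
  by move: s01; rewrite !in_itv /= => /andP[s0 s1]; apply/andP; split; lra.
Qed.

Lemma homotopic_trans f g h : homotopic f g -> homotopic g h -> homotopic f h.
Proof.
case=> H [cH fg Hends] [K [cK gh Kends]].
pose L (u : R * R) := if u.1 <= 2^-1 then H (2 * u.1, u.2)
  else K (2 * u.1 - 1, u.2).
have c2 (c : R) : continuous (fun u : R * R => (2 * u.1 - c, u.2)).
  by cont.
exists L; split.
- apply: (within_glue I2 fst 2^-1 (fun u => H (2 * u.1, u.2))
    (fun u => K (2 * u.1 - 1, u.2))) => //.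
  + exact: fst_cont.
  + have := within_comp [set u | I2 u /\ u.1 <= 2^-1] I2 _ H (c2 0).
    move=> /(_ _ cH) HL; apply: (within_eq _ _ _ _ (HL _)) => [u _ /=|].
      by rewrite subr0.
    move=> [a b] [[/= /mem01[a0 a1] ?] ?]; split=> //=.
    by apply/mem01; split; lra.
  + have := within_comp [set u | I2 u /\ 2^-1 <= u.1] I2 _ K (c2 1).
    move=> /(_ _ cK); apply.
    move=> [a b] [[/= /mem01[a0 a1] ?] ?]; split=> //=.
    by apply/mem01; split; lra.
  + move=> [a b] [/= _ b01] ->; rewrite divff// subrr.
    by have [_ ->] := fg _ b01; have [-> _] := gh _ b01.
- move=> t t01; rewrite /L /=; split.
    by rewrite invr_ge0 ler0n mulr0; have [] := fg _ t01.
  rewrite ifF; last by apply/negbTE; rewrite -ltNge; lra.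
  by rewrite mulr1 (_ : 2 - 1 = 1 :> R); [have [] := gh _ t01|lra].
- move=> s; rewrite in_itv /= => /andP[s0 s1]; rewrite /L /=; case: ifP => Hle.
    by apply: Hends; rewrite in_itv /=; apply/andP; split; lra.
  move/negbT: Hle; rewrite -ltNge => Hle.
  by apply: Kends; rewrite in_itv /=; apply/andP; split; lra.
Qed.

Lemma homotopic_reparam (f g h : loop) (phi psi : R -> R) :
  continuous phi -> continuous psi ->
  (forall t, Im t -> Im (phi t)) -> (forall t, Im t -> Im (psi t)) ->
  phi 0 = psi 0 -> phi 1 = psi 1 ->
  (forall t, Im t -> g t = f (phi t)) -> (forall t, Im t -> h t = f (psi t)) ->
  homotopic g h.
Proof.
move=> cphi cpsi Iphi Ipsi e0 e1 gE hE.
have I0 : Im 0 by apply/mem01; split; lra.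
have I1 : Im 1 by apply/mem01; split; lra.
exists (f \o (fun u => (1 - u.1) * phi u.2 + u.1 * psi u.2)); split.
- apply: (within_comp _ Im _ f _ _ (loop_cont f))
    => [|[s t] [/= /mem01[s0 s1] It]].
    have c2 (k : R -> R) : continuous k -> continuous (fun u : R * R => k u.2).
      by move=> ck x; apply: continuous_comp; [exact: snd_cont|exact: ck].
    by apply: addr_cont; apply: mulr_cont; cont; exact: c2.
  have /mem01[p0 p1] := Iphi _ It; have /mem01[q0 q1] := Ipsi _ It.
  by apply/mem01; split; nra.
- move=> t t01 /=; rewrite gE// hE// subr0 subrr !mul0r !mul1r.
  by rewrite addr0 add0r.
- move=> s _ /=; rewrite -e0 -e1 -!mulrDl subrK !mul1r.
  by rewrite -gE// -gE// loop_start loop_end.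
Qed.

Definition concat_fun (f g : R -> X) t :=
  if t <= 2^-1 then f (2 * t) else g (2 * t - 1).

Lemma affine_cont (a b : R) : continuous (fun t : R => a * t + b).
Proof. by cont. Qed.

Lemma min_cont (f g : R -> R) : continuous f -> continuous g ->
  continuous (fun t => Num.min (f t) (g t)).
Proof. by move=> cf cg x; exact: (@continuous_min R R f g x (cf x) (cg x)). Qed.

Lemma max_cont (f g : R -> R) : continuous f -> continuous g ->
  continuous (fun t => Num.max (f t) (g t)).
Proof. by move=> cf cg x; exact: (@continuous_max R R f g x (cf x) (cg x)). Qed.

Arguments affine_cont : clear implicits.
Arguments min_cont : clear implicits.
Arguments max_cont : clear implicits.

Lemma within_affine (A : set R) (f : loop) (a b : R) :
  (forall t, A t -> Im (a * t + b)) ->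
  {within A, continuous (fun t => f (a * t + b))}.
Proof.
by move=> h; exact: (within_comp A Im _ f (affine_cont a b) h (loop_cont f)).
Qed.

Lemma concat_cont (f g : loop) : {within `[0, 1], continuous (concat_fun f g)}.
Proof.
apply: (within_eq Im (fun t => if t <= 2^-1 then f (2 * t + 0)
  else g (2 * t + -1)) (concat_fun f g)) => [t _|].
  by rewrite addr0.
apply: (within_glue Im (fun t => t) 2^-1 (fun t => f (2 * t + 0))
  (fun t => g (2 * t + -1))) => //.
- exact: id_cont.
- by apply: within_affine => a [/mem01[a0 a1] ?]; apply/mem01; split; lra.
- by apply: within_affine => a [/mem01[a0 a1] ?]; apply/mem01; split; lra.
- by move=> u _ ->; rewrite addr0 divff// subrr loop_start loop_end.
Qed.

Arguments concat_cont : clear implicits.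

Lemma concat_start (f g : loop) : concat_fun f g 0 = x0.
Proof. by rewrite /concat_fun invr_ge0 ler0n mulr0 loop_start. Qed.

Lemma concat_end (f g : loop) : concat_fun f g 1 = x0.
Proof.
rewrite /concat_fun ifF; last by apply/negbTE; rewrite -ltNge; lra.
by rewrite mulr1 (_ : 2 - 1 = 1 :> R) ?loop_end//; lra.
Qed.

Definition concat f g :=
  Loop (concat_cont f g) (concat_start f g) (concat_end f g).

Lemma rev_cont (f : loop) : {within `[0, 1], continuous (fun t => f (1 - t))}.
Proof.
apply: (within_eq Im (fun t => f (-1 * t + 1)) (fun t => f (1 - t))) => [t _|].
  by rewrite mulN1r addrC.
by apply: within_affine => a /mem01[a0 a1]; apply/mem01; split; lra.
Qed.

Arguments rev_cont : clear implicits.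

Lemma rev_start (f : loop) : f (1 - 0) = x0.
Proof. by rewrite subr0 loop_end. Qed.

Lemma rev_end (f : loop) : f (1 - 1) = x0.
Proof. by rewrite subrr loop_start. Qed.

Definition rev_loop f := Loop (rev_cont f) (rev_start f) (rev_end f).

Lemma const_cont : {within `[0, 1], continuous (fun _ : R => x0)}.
Proof. by apply: continuous_subspaceT => x; exact: cvg_cst. Qed.

Arguments const_cont : clear implicits.

Definition const_loop := Loop const_cont erefl erefl.

Lemma concat_cong f f' g g' : homotopic f f' -> homotopic g g' ->
  homotopic (concat f g) (concat f' g').
Proof.
case=> H [cH ff Hends] [K [cK gg Kends]].
pose L (u : R * R) := if u.2 <= 2^-1 then H (u.1, 2 * u.2)
  else K (u.1, 2 * u.2 - 1).
have c2 (c : R) : continuous (fun u : R * R => (u.1, 2 * u.2 - c)).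
  by cont.
exists L; split.
- apply: (within_glue I2 snd 2^-1 (fun u => H (u.1, 2 * u.2))
    (fun u => K (u.1, 2 * u.2 - 1))) => //.
  + exact: snd_cont.
  + have := within_comp [set u | I2 u /\ u.2 <= 2^-1] I2 _ H (c2 0).
    move=> /(_ _ cH) HL; apply: (within_eq _ _ _ _ (HL _)) => [u _ /=|].
      by rewrite subr0.
    move=> [a b] [[/= ? /mem01[b0 b1]] ?]; split=> //=.
    by apply/mem01; split; lra.
  + have := within_comp [set u | I2 u /\ 2^-1 <= u.2] I2 _ K (c2 1).
    move=> /(_ _ cK); apply.
    move=> [a b] [[/= ? /mem01[b0 b1]] ?]; split=> //=.
    by apply/mem01; split; lra.
  + move=> [a b] [/= a01 _] ->; rewrite divff// subrr.
    by have [_ ->] := Hends _ a01; have [-> _] := Kends _ a01.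
- move=> t; rewrite in_itv /= => /andP[t0 t1].
  rewrite /L /= /concat_fun; case: ifP => Hle.
    by apply: ff; rewrite in_itv /=; apply/andP; split; lra.
  move/negbT: Hle; rewrite -ltNge => Hle.
  by apply: gg; rewrite in_itv /=; apply/andP; split; lra.
- move=> s s01; rewrite /L /=; split.
    by rewrite invr_ge0 ler0n mulr0; have [] := Hends _ s01.
  rewrite ifF; last by apply/negbTE; rewrite -ltNge; lra.
  by rewrite mulr1 (_ : 2 - 1 = 1 :> R); [have [] := Kends _ s01|lra].
Qed.

Lemma rev_cong f f' : homotopic f f' -> homotopic (rev_loop f) (rev_loop f').
Proof.
case=> H [cH ff ends]; exists (H \o (fun u => (u.1, 1 - u.2))); split.
- apply: (within_comp _ I2 _ H _ _ cH) => [|[a b] [/= ? /mem01[b0 b1]]].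
    by cont.
  by split=> //=; apply/mem01; split; lra.
- move=> t; rewrite in_itv /= => /andP[t0 t1].
  by apply: ff; rewrite in_itv /=; apply/andP; split; lra.
- by move=> s /ends[H0 H1] /=; rewrite subr0 subrr.
Qed.

Lemma min_cases (x y : R) :
  x <= y /\ Num.min x y = x \/ y <= x /\ Num.min x y = y.
Proof. by case: (leP x y) => h; [left|right; split=> //; exact: ltW]. Qed.

Lemma max_cases (x y : R) :
  y <= x /\ Num.max x y = x \/ x <= y /\ Num.max x y = y.
Proof. by case: (leP y x) => h; [left|right; split=> //; exact: ltW]. Qed.

Lemma concatA f g h :
  homotopic (concat f (concat g h)) (concat (concat f g) h).
Proof.
apply/homotopic_sym.
pose phi (t : R) :=
  Num.min (2 * t + 0) (Num.min (1 * t + 4^-1) (2^-1 * t + 2^-1)).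
have phiE t : [\/ t <= 4^-1 /\ phi t = 2 * t,
    [/\ 4^-1 < t, t <= 2^-1 & phi t = t + 4^-1] |
    2^-1 < t /\ phi t = 2^-1 * t + 2^-1].
  rewrite /phi.
  set m := Num.min (1 * t + _) _; case: (min_cases (2 * t + 0) m);
    rewrite /m; case: (min_cases (1 * t + 4^-1) (2^-1 * t + 2^-1));
    move=> -[h3 ->] -[h4 ->];
    case: (leP t 4^-1) => h1; (try by apply: Or31; split=> //; lra);
    case: (leP t 2^-1) => h2; (try by apply: Or32; split=> //; lra);
    by apply: Or33; split=> //; lra.
apply: (@homotopic_reparam (concat f (concat g h)) _ _ phi id) => //.
- exact: (min_cont _ _ (affine_cont 2 0)
    (min_cont _ _ (affine_cont 1 4^-1) (affine_cont 2^-1 2^-1))).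
- exact: id_cont.
- by move=> t /mem01[t0 t1]; apply/mem01; by case: (phiE t) => -[]; split; lra.
- by case: (phiE 0) => -[]; lra.
- by case: (phiE 1) => -[]; lra.
- move=> t /mem01[t0 t1] /=; rewrite /concat_fun /= /concat_fun.
  case: (phiE t) => -[] => [h1 ->|h1 h2 ->|h1 ->].
  + rewrite (_ : t <= 2^-1); last by lra.
    by rewrite (_ : 2 * t <= 2^-1) //; lra.
  + rewrite h2 (_ : 2 * t <= 2^-1 = false); last first.
      by apply/negbTE; rewrite -ltNge; lra.
    rewrite (_ : t + 4^-1 <= 2^-1 = false); last first.
      by apply/negbTE; rewrite -ltNge; lra.
    rewrite (_ : 2 * (t + 4^-1) - 1 <= 2^-1); last by lra.
    by congr (g _); lra.
  + rewrite (_ : t <= 2^-1 = false); last first.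
      by apply/negbTE; rewrite -ltNge; lra.
    rewrite (_ : 2^-1 * t + 2^-1 <= 2^-1 = false); last first.
      by apply/negbTE; rewrite -ltNge; lra.
    rewrite (_ : 2 * (2^-1 * t + 2^-1) - 1 <= 2^-1 = false); last first.
      by apply/negbTE; rewrite -ltNge; lra.
    by congr (h _); lra.
Qed.

Lemma concat1l f : homotopic (concat const_loop f) f.
Proof.
apply: (@homotopic_reparam f _ _ (fun t => Num.max (0 * t + 0) (2 * t + -1))
  id) => //.
- exact: (max_cont _ _ (affine_cont _ _) (affine_cont _ _)).
- exact: id_cont.
- move=> t /mem01[t0 t1]; apply/mem01; rewrite /Num.max; case: ifP => /= ?.
    by split; lra.
  by split; lra.
- by rewrite /Num.max; case: ifP => /=; lra.
- by rewrite /Num.max; case: ifP => /=; lra.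
- move=> t /mem01[t0 t1] /=; rewrite /concat_fun /Num.max; case: ifP => /= h1.
    case: ifP => /= [h2|_].
      by rewrite (_ : 2 * t + -1 = 0) ?loop_start//; lra.
    by rewrite mul0r addr0 loop_start.
  by rewrite ifT//; move/negbT: h1; rewrite -ltNge => h1; lra.
Qed.

Lemma concat1r f : homotopic (concat f const_loop) f.
Proof.
apply: (@homotopic_reparam f _ _ (fun t => Num.min (2 * t + 0) (0 * t + 1))
  id) => //.
- exact: (min_cont _ _ (affine_cont _ _) (affine_cont _ _)).
- exact: id_cont.
- move=> t /mem01[t0 t1]; apply/mem01; rewrite /Num.min; case: ifP => /= ?.
    by split; lra.
  by split; lra.
- by rewrite /Num.min; case: ifP => /=; lra.
- by rewrite /Num.min; case: ifP => /=; lra.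
- move=> t /mem01[t0 t1] /=; rewrite /concat_fun /Num.min; case: ifP => /= h1.
    case: ifP => /= [_|/negbT]; first by rewrite addr0.
    by rewrite -leNgt => h2; congr (f _); lra.
  move/negbT: h1; rewrite -ltNge => h1.
  rewrite ifF; last by apply/negbTE; rewrite -leNgt; lra.
  by rewrite mul0r add0r loop_end.
Qed.

Lemma concatVr f : homotopic (concat f (rev_loop f)) const_loop.
Proof.
apply: (@homotopic_reparam f _ _
  (fun t => Num.min (2 * t + 0) (-2 * t + 2)) (fun=> 0)) => //.
- exact: (min_cont _ _ (affine_cont _ _) (affine_cont _ _)).
- by move=> x; exact: cvg_cst.
- move=> t /mem01[t0 t1]; apply/mem01; rewrite /Num.min; case: ifP => /= ?.
    by split; lra.
  by split; lra.
- by move=> t _; apply/mem01; split; lra.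
- by rewrite /Num.min; case: ifP => /=; lra.
- by rewrite /Num.min; case: ifP => /=; lra.
- move=> t /mem01[t0 t1] /=; rewrite /concat_fun /Num.min /=.
  case: (ifP (t <= _)) => /= h1; case: ifP => /= h2.
  + by rewrite addr0.
  + by move/negbT: h2; rewrite -leNgt => h2; congr (f _); lra.
  + by move/negbT: h1; rewrite -ltNge => h1; congr (f _); lra.
  + by congr (f _); lra.
- by move=> t _; rewrite loop_start.
Qed.

Lemma concatVl f : homotopic (concat (rev_loop f) f) const_loop.
Proof.
apply: (@homotopic_reparam f _ _
  (fun t => Num.max (-2 * t + 1) (2 * t + -1)) (fun=> 1)) => //.
- exact: (max_cont _ _ (affine_cont _ _) (affine_cont _ _)).
- by move=> x; exact: cvg_cst.
- move=> t /mem01[t0 t1]; apply/mem01; rewrite /Num.max; case: ifP => /= ?.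
    by split; lra.
  by split; lra.
- by move=> t _; apply/mem01; split; lra.
- by rewrite /Num.max; case: ifP => /=; lra.
- by rewrite /Num.max; case: ifP => /=; lra.
- move=> t /mem01[t0 t1] /=; rewrite /concat_fun /Num.max /=.
  case: (ifP (t <= _)) => /= h1; case: ifP => /= h2.
  + by congr (f _); lra.
  + by congr (f _); lra.
  + by [].
  + move/negbT: h1; rewrite -ltNge => h1; move/negbT: h2; rewrite -leNgt => h2.
    by congr (f _); lra.
- by move=> t _; rewrite loop_end.
Qed.

Definition loop_pregroup := Pregroup const_homotopy_refl homotopic_sym
  homotopic_trans concat_cong rev_cong concatA concat1l concat1r
  concatVl concatVr.

Definition pi1 := pquot loop_pregroup.
HB.instance Definition _ := Group.copy pi1 (pquot loop_pregroup).

End FundamentalGroup.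

Section QuotientGroup.
Variables (G : groupType).
Local Open Scope group_scope.

Definition normal_subgroup (K : set G) :=
  [/\ K 1, forall x y, K x -> K y -> K (x * y), forall x, K x -> K x^-1 &
      forall x g, K x -> K (g * x * g^-1)].

Definition normal_closure (A : set G) : set G := smallest normal_subgroup A.

Lemma normal_closure_normal A : normal_subgroup (normal_closure A).
Proof.
split=> [K [[]]//|x y Kx Ky K KA|x Kx K KA|x g Kx K KA];
  have [[K1 KM KV KJ] _] := KA.
- by apply: KM; [exact: Kx|exact: Ky].
- by apply: KV; exact: Kx.
- by apply: KJ; exact: Kx.
Qed.

Variable A : set G.
Let K := normal_closure A.
Let K1 : K 1. Proof. by have [] := normal_closure_normal A. Qed.
Let KM x y : K x -> K y -> K (x * y).
Proof. by have [_ + _ _] := normal_closure_normal A; apply. Qed.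
Let KV x : K x -> K x^-1.
Proof. by have [_ _ + _] := normal_closure_normal A; apply. Qed.
Let KJ x g : K x -> K (g * x * g^-1).
Proof. by have [_ _ _] := normal_closure_normal A; apply. Qed.

Definition coset_eq (x y : G) := K (x^-1 * y).

Lemma coset_eq_refl x : coset_eq x x.
Proof. by rewrite /coset_eq mulVg. Qed.
Lemma coset_eq_sym x y : coset_eq x y -> coset_eq y x.
Proof. by move=> /KV; rewrite invgM invgK. Qed.
Lemma coset_eq_trans x y z : coset_eq x y -> coset_eq y z -> coset_eq x z.
Proof. by move=> xy yz; have := KM xy yz; rewrite mulgA mulgK. Qed.
Lemma coset_eq_mul x x' y y' : coset_eq x x' -> coset_eq y y' ->
  coset_eq (x * y) (x' * y').
Proof.
move=> xx yy; have := KM (KJ y^-1 xx) yy.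
by rewrite /coset_eq invgK invgM !mulgA mulgK.
Qed.
Lemma coset_eq_inv x x' : coset_eq x x' -> coset_eq x^-1 x'^-1.
Proof.
move=> /coset_eq_sym xx; have := KJ x' xx.
by rewrite /coset_eq invgK !mulgA mulgV mul1g.
Qed.
Lemma coset_eq_eq x y : x = y -> coset_eq x y.
Proof. by move=> ->; exact: coset_eq_refl. Qed.

Definition coset_pregroup := @Pregroup G coset_eq (fun x y => x * y) 1
  (fun x => x^-1) coset_eq_refl coset_eq_sym coset_eq_trans coset_eq_mul
  coset_eq_inv (fun x y z => coset_eq_eq (mulgA x y z))
  (fun x => coset_eq_eq (mul1g x)) (fun x => coset_eq_eq (mulg1 x))
  (fun x => coset_eq_eq (mulVg x)) (fun x => coset_eq_eq (mulgV x)).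

(* G / <<A>>, the quotient by the normal closure of A *)
Definition quot_group : Type := pquot coset_pregroup.
HB.instance Definition _ := Group.copy quot_group (pquot coset_pregroup).

Definition quot_proj (x : G) : quot_group := pcls (x : coset_pregroup).
End QuotientGroup.

Section FreeGroup.
Variable I : Type.

(* (i, false) is the letter x_i and (i, true) its inverse *)
Definition word := seq (I * bool).
Definition letter_inv (l : I * bool) := (l.1, ~~ l.2).

Inductive free_eq : word -> word -> Prop :=
| free_refl w : free_eq w w
| free_sym w w' : free_eq w w' -> free_eq w' w
| free_trans w1 w2 w3 : free_eq w1 w2 -> free_eq w2 w3 -> free_eq w1 w3
| free_cancel u l v : free_eq (u ++ l :: letter_inv l :: v) (u ++ v).

Definition word_inv (w : word) : word := rev [seq letter_inv l | l <- w].

Lemma letter_invK : involutive letter_inv.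
Proof. by case=> i b; rewrite /letter_inv /= negbK. Qed.

Lemma free_cat u u' v v' : free_eq u u' -> free_eq v v' ->
  free_eq (u ++ v) (u' ++ v').
Proof.
move=> uu vv; apply: (@free_trans _ (u' ++ v)).
  elim: uu => {u u'} [w|w w' _|w1 w2 w3 _ h1 _ h2|w l w'].
  - exact: free_refl.
  - exact: free_sym.
  - exact: free_trans h1 h2.
  - by rewrite -!catA; exact: free_cancel.
elim: vv => {v v'} [w|w w' _|w1 w2 w3 _ h1 _ h2|w l w'].
- exact: free_refl.
- exact: free_sym.
- exact: free_trans h1 h2.
- by rewrite !catA; exact: free_cancel.
Qed.

Lemma free_inv w w' : free_eq w w' -> free_eq (word_inv w) (word_inv w').
Proof.
elim=> {w w'} [w|w w' _|w1 w2 w3 _ h1 _ h2|w l w'].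
- exact: free_refl.
- exact: free_sym.
- exact: free_trans h1 h2.
- rewrite /word_inv !map_cat !rev_cat /= !rev_cons -!cats1 -!catA /=.
  rewrite letter_invK.
  exact: free_cancel.
Qed.

Lemma free_mulVr w : free_eq (w ++ word_inv w) [::].
Proof.
elim: w => [|l w IH]; first exact: free_refl.
rewrite /word_inv /= rev_cons -cats1 catA.
apply: (@free_trans _ ([:: l] ++ [:: letter_inv l])).
  exact: (free_cat (free_cat (free_refl [:: l]) IH)
    (free_refl [:: letter_inv l])).
exact: (free_cancel [::] l [::]).
Qed.

Lemma word_invK : involutive word_inv.
Proof.
by move=> w; rewrite /word_inv map_rev revK mapK //; exact: letter_invK.
Qed.

Lemma free_mulVl w : free_eq (word_inv w ++ w) [::].
Proof. by have := free_mulVr (word_inv w); rewrite word_invK. Qed.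

Lemma free_of_eq w w' : w = w' -> free_eq w w'.
Proof. by move=> ->; exact: free_refl. Qed.

Definition free_pregroup := @Pregroup word free_eq cat [::] word_inv
  free_refl free_sym free_trans free_cat free_inv
  (fun u v w => free_of_eq (catA u v w)) (fun w => free_refl w)
  (fun w => free_of_eq (cats0 w)) free_mulVl free_mulVr.

Definition free_group : Type := pquot free_pregroup.
HB.instance Definition _ := Group.copy free_group (pquot free_pregroup).

Definition free_gen (i : I) : free_group :=
  pcls ([:: (i, false)] : free_pregroup).
End FreeGroup.

(* G = < x_i | rels >, the generator x_i being sent to g i *)
Definition presented_by (G : groupType) (I : Type) (g : I -> G)
    (rels : set (free_group I)) :=
  exists phi : {multiplicative quot_group rels -> G},
    bijective phi /\ forall i, phi (quot_proj rels (free_gen i)) = g i.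

(* The complex X^1: vertex V_k has label k; entry s of triangles1 lists the
   vertices of a triangle; entry k - 1 of edges1 lists the ends of the
   non-redundant edge k. *)
Definition triangles1 : seq (seq nat) :=
  [:: [:: 1; 5; 3]; [:: 1; 3; 4]; [:: 1; 4; 6]; [:: 1; 6; 5];
      [:: 2; 3; 4]; [:: 2; 3; 8]; [:: 2; 8; 7]; [:: 2; 7; 4]]%N.
Definition triangle1 (s : 'I_8) : seq nat := nth [::] triangles1 s.

Definition edges1 : seq (seq nat) :=
  [:: [:: 1; 5]; [:: 1; 3]; [:: 1; 6]; [:: 1; 4]; [:: 3; 4];
      [:: 2; 4]; [:: 2; 3]; [:: 2; 7]; [:: 2; 8]]%N.
Definition edge1 (k : 'I_9) : seq nat := nth [::] edges1 k.

Section Relations.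
Variables (G : groupType) (x x' : nat -> G).
Local Open Scope group_scope.

Definition vk_comm (a b : G) := a * b * a^-1 * b^-1.
Definition vk_braid (a b : G) := a * b * a * b^-1 * a^-1 * b^-1.
Definition vk_eq (a b : G) := a * b^-1.

Definition vk_rel4 (i j k l : nat) : seq G :=
  let a := x i in let a' := x' i in let b := x j in let b' := x' j in
  let c := x k in let c' := x' k in let d := x l in let d' := x' l in
  [:: vk_braid a' b; vk_braid a' b'; vk_braid a' (b^-1 * b' * b);
      vk_braid c d; vk_braid c' d; vk_braid (c^-1 * c' * c) d;
      vk_comm (b' * b * a' * b^-1 * b'^-1) d;
      vk_comm (b' * b * a' * b^-1 * b'^-1)
        (c^-1 * c'^-1 * d^-1 * d' * d * c' * c);
      vk_braid a b; vk_braid a b'; vk_braid a (b^-1 * b' * b);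
      vk_braid c (d^-1 * d' * d); vk_braid c' (d^-1 * d' * d);
      vk_braid (c^-1 * c' * c) (d^-1 * d' * d);
      vk_comm (b' * b * a * b^-1 * b'^-1) (d^-1 * d' * d);
      vk_comm (b' * b * a * b^-1 * b'^-1)
        (c^-1 * c'^-1 * d^-1 * d'^-1 * d * d' * d * c' * c);
      vk_eq (b' * b * a' * b * a'^-1 * b^-1 * b'^-1) (d * c' * d^-1);
      vk_eq (b' * b * a' * b' * a'^-1 * b^-1 * b'^-1)
        (d * c' * c * c'^-1 * d^-1);
      vk_eq (b' * b * a * b * a^-1 * b^-1 * b'^-1)
        (d^-1 * d' * d * c' * d^-1 * d'^-1 * d);
      vk_eq (b' * b * a * b' * a^-1 * b^-1 * b'^-1)
        (d^-1 * d' * d * c' * c * c'^-1 * d^-1 * d'^-1 * d)].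

Definition vk_rel3 (i j k : nat) : seq G :=
  let a := x i in let a' := x' i in let b := x j in let b' := x' j in
  let c := x k in let c' := x' k in
  [:: vk_braid a' b; vk_braid a' b'; vk_braid a' (b^-1 * b' * b);
      vk_eq a (b' * b * a' * b^-1 * b'^-1);
      vk_braid c (b' * b * a' * b * a'^-1 * b^-1 * b'^-1);
      vk_braid c (b' * b * a' * b' * a'^-1 * b^-1 * b'^-1);
      vk_braid c (b' * b * a' * b^-1 * b' * b * a'^-1 * b^-1 * b'^-1);
      vk_eq c' (c * b' * b * a' * b' * b * a'^-1 * b^-1 * b'^-1 * c
        * b' * b * a' * b^-1 * b'^-1 * a'^-1 * b^-1 * b'^-1 * c^-1);
      vk_comm a c; vk_comm a c'; vk_comm a' c; vk_comm a' c'].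

Definition vk_rel5 (p : nat * nat) : seq G :=
  [seq vk_comm y z | y <- [:: x p.1; x' p.1], z <- [:: x p.2; x' p.2]].

Definition disjoint_pairs : seq (nat * nat) :=
  ([seq (i, j) | i <- [:: 1; 3], j <- [:: 5; 6; 7; 8; 9]] ++
   [seq (i, j) | i <- [:: 2], j <- [:: 6; 8; 9]] ++
   [seq (i, j) | i <- [:: 4], j <- [:: 7; 8; 9]] ++
   [seq (i, j) | i <- [:: 5], j <- [:: 8; 9]])%N.

Definition vk_relators : seq G :=
  vk_rel4 1 2 3 4 ++ vk_rel4 6 7 8 9 ++ vk_rel3 2 5 7 ++ vk_rel3 4 5 6 ++
  [seq vk_eq (x i) (x' i) | i <- [:: 1; 3; 8; 9]%N] ++
  flatten [seq vk_rel5 p | p <- disjoint_pairs] ++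
  [:: \prod_(i <- rev (iota 1 9)) (x' i * x i)].
End Relations.

(* The index (k - 1, false) stands for gamma_k, and (k - 1, true) for
   gamma_k'. *)
Notation vk_index := ('I_9 * bool)%type.
Definition relators1 : set (free_group vk_index) :=
  [set` vk_relators (fun k => free_gen (inord k.-1 : 'I_9, false))
                    (fun k => free_gen (inord k.-1 : 'I_9, true))].

Definition squares (G : groupType) (g : vk_index -> G) : set G :=
  [set (g i ^+ 2)%g | i in setT].

(* exactness of 1 -> K -> Q -> S -> 1 *)
Definition short_exact (K Q S : groupType) (iota : K -> Q) (rho : Q -> S) :=
  [/\ injective iota, (forall q, rho q = 1%g <-> exists k, iota k = q) &
      forall s, exists q, rho q = s].

Definition transposition_rule (Q : groupType) (cls : vk_index -> Q)
    (rho : Q -> 'S_8) :=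
  forall (k : 'I_9) (b : bool) (s t : 'I_8), s != t ->
    {subset edge1 k <= triangle1 s} -> {subset edge1 k <= triangle1 t} ->
    rho (cls (k, b)) = tperm s t.

Section Geometry.
Variable R : realType.

(* the complex numbers, as a numClosedFieldType so that they carry the
   topology of their norm *)
Definition Cx : numClosedFieldType := R[i].
Notation C := Cx.

Section ProjectiveSpace.
Variable N : nat.

Definition nzvec : Type := set_type [set v : 'rV[C]_N.+1 | v != 0]%classic.
HB.instance Definition _ := Topological.on nzvec.

Definition collinear : rel nzvec :=
  fun u v => `[< exists2 c : C, c != 0 & \val u = c *: \val v >].

Lemma collinear_refl : reflexive collinear.
Proof. by move=> u; apply/asboolP; exists 1; rewrite ?oner_eq0 ?scale1r. Qed.

Lemma collinear_sym : symmetric collinear.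
Proof.
suff h u v : collinear u v -> collinear v u.
  by move=> u v; apply/idP/idP; exact: h.
move=> /asboolP[c c0 uv]; apply/asboolP; exists c^-1; first by rewrite invr_eq0.
by rewrite uv scalerA mulVf// scale1r.
Qed.

Lemma collinear_trans : transitive collinear.
Proof.
move=> v u w /asboolP[c c0 uv] /asboolP[d d0 vw]; apply/asboolP.
by exists (c * d); rewrite ?mulf_neq0// uv vw scalerA.
Qed.

Canonical collinear_equiv :=
  EquivRel collinear collinear_refl collinear_sym collinear_trans.

(* CP^N with the quotient topology *)
Definition CP : Type := quotient_topology {eq_quot collinear_equiv}.
HB.instance Definition _ := Topological.on CP.
HB.instance Definition _ := Quotient.on CP.

(* v is a vector of homogeneous coordinates of x *)
Definition hcoord (x : CP) (v : 'rV[C]_N.+1) :=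
  exists2 u : nzvec, \val u = v & \pi_CP u = x.

Definition cone (Y : set CP) : set 'rV[C]_N.+1 :=
  [set v | exists2 x, Y x & hcoord x v].

Definition eval (p : mpoly.mpoly N.+1 C) (v : 'rV[C]_N.+1) : C :=
  mpoly.meval (fun i => v 0 i) p.

Definition homogeneous (p : mpoly.mpoly N.+1 C) :=
  exists d : nat, p \is mpoly.ishomog1 d mpoly.mdeg.

Definition zariski_closed (Y : set CP) :=
  exists2 P : set (mpoly.mpoly N.+1 C), P `<=` homogeneous &
    Y = [set x | forall v p, hcoord x v -> P p -> eval p v = 0].

Definition irreducible_closed (Y : set CP) :=
  [/\ zariski_closed Y, Y !=set0 &
      forall Y1 Y2, zariski_closed Y1 -> zariski_closed Y2 ->
        Y `<=` Y1 `|` Y2 -> Y `<=` Y1 \/ Y `<=` Y2].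

Definition irreducible_chain (Y : set CP) (d : nat) (Z : nat -> set CP) :=
  (forall i, (i <= d)%N -> irreducible_closed (Z i) /\ Z i `<=` Y) /\
  (forall i, (i < d)%N -> Z i `<` Z i.+1).

Definition krull_dim (Y : set CP) (d : nat) :=
  (exists Z, irreducible_chain Y d Z) /\
  (forall e Z, irreducible_chain Y e Z -> (e <= d)%N).

Definition projective_surface (X : set CP) :=
  irreducible_closed X /\ krull_dim X 2.

(* The general linear subspace of codimension 2 meets the surface X in
   exactly d points. *)
Definition surface_degree (X : set CP) (d : nat) :=
  exists2 Q : mpoly.mpoly (N.+1 * 2) C, Q != 0 &
    forall L : 'M[C]_(N.+1, 2), mpoly.meval (fun i => mxvec L 0 i) Q != 0 ->
      ([set x | X x /\ forall v, hcoord x v -> v *m L = 0] #= `I_d)%card.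
End ProjectiveSpace.

(* A local holomorphic parametrization g of the analytic set Y, smooth of
   dimension 2 at the point with homogeneous coordinates g 0 = v; g takes its
   values in the cone over Y, is an immersion transverse to the lines of the
   cone, and is open onto Y. *)
Definition local_chart N (Y : set (CP N)) (v : 'rV[C]_N.+1)
    (U : set 'rV[C]_2) (g : 'rV[C]_2 -> 'rV[C]_N.+1) :=
  [/\ open U /\ U 0, g 0 = v,
      forall u, U u -> differentiable g u /\ cone Y (g u),
      \rank (col_mx v (jacobian g 0)) = 3%N &
      forall W, nbhs (0 : 'rV[C]_2) W -> exists O : set (CP N),
        [/\ open O, (forall x, hcoord x v -> O x) &
            forall x, Y x -> O x -> exists2 u, W u /\ U u & hcoord x (g u)]].

Section Projection.
Variables (N : nat) (X : set (CP N)) (A : 'M[C]_(N.+1, 3)).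

(* The linear projection with matrix A maps x to q. *)
Definition projects (x : CP N) (q : CP 2) :=
  exists v, hcoord x v /\ hcoord q (v *m A).

Definition pair_row (a b : C) : 'rV[C]_2 :=
  \row_j (if j == 0 then a else b).

Definition fold_map (u : 'rV[C]_2) := pair_row (u 0 0) (u 0 1 ^+ 2).
Definition cusp_map (u : 'rV[C]_2) :=
  pair_row (u 0 0) (u 0 0 * u 0 1 + u 0 1 ^+ 3).

(* In suitable local coordinates the projection is given by nf near x. *)
Definition has_germ (nf : 'rV[C]_2 -> 'rV[C]_2) (x : CP N) :=
  exists v U g W h,
    [/\ hcoord x v, local_chart X v U g,
        local_chart [set: CP 2] (v *m A) W h &
        forall u, U u -> W (nf u) /\
          exists2 c : C, c != 0 & g u *m A = c *: h (nf u)].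

Definition unramified (x : CP N) := has_germ id x.
Definition ramified (x : CP N) := X x /\ ~ unramified x.

Definition branch_curve : set (CP 2) :=
  [set q | exists2 x, ramified x & projects x q].

Definition transverse_images (x y : CP N) :=
  forall v w U g U' g', hcoord x v -> hcoord y w ->
    local_chart X v U g -> local_chart X w U' g' ->
    \rank (col_mx (col_mx v (jacobian g 0) *m A)
                  (col_mx w (jacobian g' 0) *m A)) = 3%N.

(* The center of the projection misses X, the only singularities of the
   projection are folds and cusps, and the only singularities of the branch
   curve are nodes and cusps. *)
Definition generic_projection :=
  [/\ \rank A = 3%N,
      forall v, cone X v -> v *m A != 0,
      forall x, X x -> [\/ unramified x, has_germ fold_map x |
                            has_germ cusp_map x],
      forall x y q, ramified x -> ramified y -> x <> y ->
        projects x q -> projects y q ->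
        [/\ has_germ fold_map x, has_germ fold_map y & transverse_images x y] &
      forall x y z q, ramified x -> ramified y -> ramified z ->
        projects x q -> projects y q -> projects z q ->
        [\/ x = y, y = z | x = z]].

Definition galois_cover (n : nat) :
    set (prod_topology (fun _ : 'I_n => CP N)) :=
  closure [set x : prod_topology (fun _ : 'I_n => CP N) |
    [/\ injective x, (forall i, X (x i)) &
        exists q, forall i, projects (x i) q]].
End Projection.

Definition holo_on n m (O : set (C * 'rV[C]_n))
    (f : C * 'rV[C]_n -> 'rV[C]_m) :=
  open O /\ forall p, O p -> differentiable f p.

Section Family.
Variables (M : nat) (V : set (C * CP M)).

Definition fibre (t : C) : set (CP M) := [set x | V (t, x)].

(* the cone over V, in C x C^(M+1) *)
Definition fcone : set (C * 'rV[C]_M.+1) := [set p | cone (fibre p.1) p.2].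

(* V is a closed analytic subset of Delta x CP^M, Delta the unit disc. *)
Definition analytic_family :=
  (forall t x, V (t, x) -> `|t| < 1) /\
  forall t (v : 'rV[C]_M.+1), `|t| < 1 -> v != 0 ->
    exists m O (h : C * 'rV[C]_M.+1 -> 'rV[C]_m),
      [/\ holo_on O h, O (t, v) & forall p, O p -> (fcone p <-> h p = 0)].

(* Flatness over Delta: the local rings of Delta are discrete valuation rings,
   so it says that t - t0 is not a zero divisor in the local rings of V. *)
Definition flat_family :=
  forall t0 v O (h : C * 'rV[C]_M.+1 -> 'rV[C]_1), fcone (t0, v) ->
    holo_on O h -> O (t0, v) ->
    (forall p, O p -> fcone p -> (p.1 - t0) *: h p = 0) ->
    exists2 O', open O' /\ O' (t0, v) &
      forall p, O' p -> fcone p -> h p = 0.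

(* The analytic fibre over 0 is reduced: a function vanishing on the set
   fibre 0 is a multiple of t on V. *)
Definition reduced_central_fibre :=
  forall v O (h : C * 'rV[C]_M.+1 -> 'rV[C]_1), fcone (0, v) ->
    holo_on O h -> O (0, v) ->
    (forall p, O p -> fcone p -> p.1 = 0 -> h p = 0) ->
    exists O' (k : C * 'rV[C]_M.+1 -> 'rV[C]_1),
      [/\ holo_on O' k, O' (0, v) &
          forall p, O' p -> fcone p -> h p = p.1 *: k p].

(* V -> Delta is smooth of relative dimension 2 over Delta minus 0: near each
   point V is parametrized by (t, u) |-> (t, [g (t, u)]). *)
Definition smooth_off_zero :=
  forall t v, t != 0 -> fcone (t, v) ->
    exists U (g : C * 'rV[C]_2 -> 'rV[C]_M.+1),
      [/\ holo_on U g /\ U (t, 0), g (t, 0) = v,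
          forall p, U p -> fcone (p.1, g p),
          \rank (col_mx v (jacobian (fun u => g (t, u)) 0)) = 3%N &
          forall W, nbhs (t, 0 : 'rV[C]_2) W ->
            exists O : set (C * CP M),
              [/\ open O, (forall x, hcoord x v -> O (t, x)) &
                  forall p, V p -> O p ->
                    exists2 u, W (p.1, u) /\ U (p.1, u) &
                      hcoord p.2 (g (p.1, u))]].

(* F : V -> CP^2 is holomorphic: it lifts locally to a holomorphic map between
   the cones. *)
Definition holo_family_map (F : C * CP M -> CP 2) :=
  forall p, fcone p -> exists O (G : C * 'rV[C]_M.+1 -> 'rV[C]_3),
    [/\ holo_on O G, O p &
        forall p', O p' -> fcone p' -> forall x, hcoord x p'.2 ->
          hcoord (F (p'.1, x)) (G p')].
End Family.

Definition holo_map N M (Y : set (CP N)) (phi : CP N -> CP M) :=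
  forall v, cone Y v -> exists O (G : 'rV[C]_N.+1 -> 'rV[C]_M.+1),
    [/\ open O, (forall w, O w -> differentiable G w), O v &
        forall w, O w -> cone Y w -> forall x, hcoord x w ->
          hcoord (phi x) (G w)].

Definition biholomorphic N M (Y : set (CP N)) (Z : set (CP M))
    (phi : CP N -> CP M) :=
  holo_map Y phi /\ (forall x, Y x -> Z (phi x)) /\
  exists psi : CP M -> CP N,
    [/\ holo_map Z psi, (forall z, Z z -> Y (psi z)),
        (forall x, Y x -> psi (phi x) = x) &
        (forall z, Z z -> phi (psi z) = z)].

(* The map F of the family is (t, y) |-> (t, F2 (t, y)), so only its second
   component F2 appears; it is not required to be injective. *)
Definition projective_degeneration N0 (X0 : set (CP N0)) (A0 : 'M[C]_(N0.+1, 3))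
    N (Y : set (CP N)) (A : 'M[C]_(N.+1, 3)) :=
  exists M (V : set (C * CP M)) (F2 : C * CP M -> CP 2) (t0 : C)
      (phi0 : CP N0 -> CP M) (phi : CP N -> CP M),
    [/\ analytic_family V, flat_family V, reduced_central_fibre V,
        smooth_off_zero V & holo_family_map V F2] /\
    [/\ t0 != 0 /\ `|t0| < 1,
        biholomorphic X0 (fibre V 0) phi0, biholomorphic Y (fibre V t0) phi,
        forall x, X0 x -> projects A0 x (F2 (0, phi0 x)) &
        forall x, Y x -> projects A x (F2 (t0, phi x))].

Section Planes.
Variables (M n : nat) (B : 'I_n -> 'M[C]_(3, M.+1)).

(* the union of the planes spanned by the rows of the B s *)
Definition union_of_planes : set (CP M) :=
  [set x | exists s v, hcoord x v /\ (v <= B s)%MS].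

(* The planes have the given shadow: the plane B s is spanned by the corners
   of the triangle tri s, two planes meet exactly in the span of the common
   corners of their triangles, and only two planes meet along any line. *)
Definition has_shadow (tri : 'I_n -> seq nat) :=
  (exists Q : nat -> 'rV[C]_M.+1,
    (forall s, \rank (B s) = 3%N /\ (B s :=: \sum_(i <- tri s) <<Q i>>)%MS) /\
    (forall s t, s != t ->
      let common := [seq i <- tri s | i \in tri t] in
      (B s :&: B t :=: \sum_(i <- common) <<Q i>>)%MS /\
      \rank (B s :&: B t)%MS = size common)) /\
  (forall s t r, s != t -> t != r -> s != r ->
    (\rank (B s :&: B t :&: B r)%MS <= 1)%N).

Definition double_line (L : 'M[C]_M.+1) :=
  exists s t, [/\ s != t, \rank (B s :&: B t)%MS = 2%N & L = (B s :&: B t)%MS].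

(* The center misses the planes; the images of the double lines are distinct,
   and concurrent only if the lines are. *)
Definition generic_planes_projection (A : 'M[C]_(M.+1, 3)) :=
  [/\ \rank A = 3%N,
      forall s (v : 'rV[C]_M.+1), v != 0 -> (v <= B s)%MS -> v *m A != 0,
      forall L1 L2, double_line L1 -> double_line L2 ->
        (L1 *m A :=: L2 *m A)%MS -> (L1 :=: L2)%MS &
      forall L1 L2 L3, double_line L1 -> double_line L2 -> double_line L3 ->
        ~~ (L1 == L2)%MS -> ~~ (L2 == L3)%MS -> ~~ (L1 == L3)%MS ->
        (0 < \rank ((L1 *m A) :&: (L2 *m A) :&: (L3 *m A))%MS)%N ->
        (0 < \rank (L1 :&: L2 :&: L3)%MS)%N].
End Planes.

Definition degenerates_to_shadow N (X : set (CP N)) n (tri : 'I_n -> seq nat) :=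
  exists N0 (B : 'I_n -> 'M[C]_(3, N0.+1)) (A0 : 'M[C]_(N0.+1, 3))
      (A : 'M[C]_(N.+1, 3)),
    [/\ has_shadow B tri, generic_planes_projection B A0,
        generic_projection X A &
        projective_degeneration (union_of_planes B) A0 X A].
End Geometry.
Arguments galois_cover {R N} X A n _.

(* Main.v *)
(** In G / <<gamma^2>> all generators are involutions.  Two involutions b, b'
that satisfy the braid relation with a third one a are equal as soon as a
commutes with bb'; together with cancellation in (R4) and with (R1), (R3) this
identifies gamma_i' with gamma_i for every i.  The relation aba = dcd of the
two 4-cycles then eliminates gamma_2 and gamma_7, and the other seven
generators satisfy the Coxeter relations of type A_7 along a Hamiltonian path
of the dual graph.  Normal forms in that Coxeter group show that the map to S_8
is injective, so its kernel, the fundamental group of X_Gal, is trivial. *)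
From HB Require Import structures.
Require Import Defs.
From mathcomp Require Import all_boot all_order all_algebra all_fingroup.
From mathcomp Require Import all_classical all_reals all_analysis.
From mathcomp Require Import complex.

Set Implicit Arguments.
Unset Strict Implicit.
Unset Printing Implicit Defensive.

Local Open Scope classical_set_scope.
Local Open Scope ring_scope.

(** * Group homomorphisms *)

Lemma multiplicative1 (G H : groupType) (f : {multiplicative G -> H}) :
  f 1%g = 1%g.
Proof. by apply: (mulgI (f 1%g)); rewrite -gmulfM !mulg1. Qed.

Lemma multiplicativeV (G H : groupType) (f : {multiplicative G -> H}) :
  {morph f : x / x^-1}%g.
Proof.
by move=> x; apply: (mulgI (f x)); rewrite -gmulfM !mulgV multiplicative1.
Qed.

(** * Normal forms for the Coxeter relations of type A *)

Section TypeA.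
Variables (Q : groupType) (s : nat -> Q) (n : nat).
Local Open Scope group_scope.
Hypothesis s2 : forall i, (i < n)%N -> s i * s i = 1.
Hypothesis s_comm : forall i j, (i.+1 < j < n)%N -> s i * s j = s j * s i.
Hypothesis s_braid : forall i, (i.+1 < n)%N ->
  s i * s i.+1 * s i = s i.+1 * s i * s i.+1.

(** Indices decrease from [k + d - 1] to [k]. In type A the words with [k + d = m] are the minimal
    right coset representatives of one parabolic subgroup in the next. *)
Fixpoint descent k d : Q := if d is e.+1 then descent k.+1 e * s k else 1.

Lemma descent_comm i k d : (i.+1 < k)%N -> (k + d <= n)%N ->
  descent k d * s i = s i * descent k d.
Proof.
elim: d k => [|d IH] k ik kd /=; first by rewrite mul1g mulg1.
rewrite -mulgA -s_comm; last by rewrite ik (leq_trans _ kd)// -addSnnS leq_addr.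
by rewrite !mulgA IH// ?addSnnS// ltnW.
Qed.

(** Moving left, [s i.+1] commutes with the letters below [s i], becomes [s i] by the braid
    relation, then commutes with the letters above [s i.+1]. *)
Lemma descent_shift i k d : (k <= i)%N -> (i.+1 < k + d)%N -> (k + d <= n)%N ->
  descent k d * s i.+1 = s i * descent k d.
Proof.
elim: d k => [|d IH] k ki id kd /=.
  by move: id; rewrite addn0 ltnNge (leq_trans ki).
have [ik|ik] := eqVneq i k; last first.
  have {}ki : (k < i)%N by rewrite ltn_neqAle eq_sym ik.
  have in_ : (i.+1 < n)%N by apply: leq_trans kd.
  rewrite -mulgA s_comm ?ltnS ?ki//.
  by rewrite !mulgA IH// addSnnS.
subst i => {ki}; case: d IH id kd => [|d] IH id kd /=.
  by rewrite addn1 ltnn in id.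
rewrite -!mulgA (mulgA (s k.+1)) -s_braid; last by apply: leq_trans kd.
rewrite !mulgA descent_comm//.
by rewrite !addSnnS.
Qed.

(* The subgroup generated by s 0, ..., s m.-1, as the set of its normal forms
   along the chain of parabolic subgroups. *)
Fixpoint parabolic m (w : Q) : Prop :=
  if m is m'.+1 then
    exists h k d, [/\ parabolic m' h, (k + d = m)%N & w = h * descent k d]
  else w = 1.

Lemma parabolic1 m : parabolic m 1.
Proof.
elim: m => //= m IH; exists 1, m.+1, 0%N; split; rewrite ?addn0//.
by rewrite mulg1.
Qed.

(** The new letter passes the descent into [h], unchanged or lowered by one, or cancels the last
    letter [s k], or, when [i.+1 = k], lengthens the descent. *)
Lemma parabolicM m w i : (m <= n)%N -> (i < m)%N -> parabolic m w ->
  parabolic m (w * s i).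
Proof.
elim: m w i => // m IH w i mn im /= [h [k [d [hh kd ->]]]].
have mn' : (m <= n)%N by apply: ltnW.
case: (ltngtP i.+1 k) => [ik|ki|ik].
- exists (h * s i), k, d; split=> //.
    apply: IH => //; rewrite -ltnS; apply: leq_trans ik _.
    by rewrite -kd leq_addr.
  by rewrite -!mulgA descent_comm ?kd.
- rewrite ltnS in ki; have [ik|ik] := eqVneq i k.
    case: d kd => [|d] kd.
      by move: im; rewrite ik -kd addn0 ltnn.
    exists h, k.+1, d; split=> //; first by rewrite addSnnS.
    by rewrite /= ik -!mulgA s2 ?mulg1// -ik (leq_trans im).
  case: i => [|i] in im ki ik *; first by move: ki ik; case: (k).
  have {}ki : (k <= i)%N by rewrite -ltnS ltn_neqAle eq_sym ik.
  exists (h * s i), k, d; split=> //; first by apply: IH.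
  by rewrite -!mulgA descent_shift ?kd.
- exists h, i, d.+1; split=> //; first by rewrite -addSnnS ik.
  by rewrite /= ik mulgA.
Qed.

(** * Faithfulness of the action on a chain of points *)

Variables (T : finType) (rho : {multiplicative Q -> {perm T}}) (p : nat -> T).
Hypothesis p_inj : forall i j, (i <= n)%N -> (j <= n)%N -> p i = p j -> i = j.
Hypothesis rho_s : forall i, (i < n)%N -> rho (s i) = tperm (p i) (p i.+1).

Lemma descent_top k d : (k + d <= n)%N -> rho (descent k d) (p (k + d)%N) = p k.
Proof.
elim: d k => [|d IH] k kd /=; first by rewrite multiplicative1 perm1 addn0.
rewrite gmulfM permM -addSnnS IH ?addSnnS// rho_s ?tpermR//.
by apply: leq_trans kd; rewrite -addSnnS leq_addr.
Qed.

Lemma descent_fix k d j : (k + d < j)%N -> (j <= n)%N ->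
  rho (descent k d) (p j) = p j.
Proof.
elim: d k => [|d IH] k kd jn /=; first by rewrite multiplicative1 perm1.
have kj : (k.+1 < j)%N by apply: leq_ltn_trans kd; rewrite -addSnnS leq_addr.
have kn : (k.+1 < n)%N by apply: leq_trans kj jn.
have p_neq i : (i < j)%N -> p i != p j.
  move=> ij; apply/eqP => /(p_inj (ltnW (leq_trans ij jn)) jn) e.
  by rewrite e ltnn in ij.
rewrite gmulfM permM IH ?addSnnS// rho_s; last by apply: ltnW.
by rewrite tpermD// p_neq// ltnW.
Qed.

Lemma parabolic_fix m w j : parabolic m w -> (m < j)%N -> (j <= n)%N ->
  rho w (p j) = p j.
Proof.
elim: m w => [|m IH] w /=.
  by move=> -> _ _; rewrite multiplicative1 perm1.
move=> [h [k [d [hh kd ->]]]] mj jn.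
by rewrite gmulfM permM IH// ?descent_fix ?kd// ltnW.
Qed.

(** As [h] fixes [p m.+1] and the descent sends it to [p k], triviality forces [k = m.+1]: the
    descent is empty, and induction applies to [h]. *)
Lemma parabolic_inj m w : (m <= n)%N -> parabolic m w -> rho w = 1 -> w = 1.
Proof.
elim: m w => // m IH w mn /= [h [k [d [hh kd ->]]]] rho1.
have := congr1 (fun f : {perm T} => f (p m.+1)) rho1.
rewrite gmulfM permM (parabolic_fix hh)// perm1 -{1}kd descent_top ?kd//.
have kn : (k <= n)%N by apply: leq_trans mn; rewrite -kd leq_addr.
move=> /(p_inj kn mn) ekm.
have d0 : d = 0%N by apply/eqP; rewrite -(eqn_add2l k) kd ekm addn0.
move: rho1; rewrite d0 /= !mulg1 => rho1.
by apply: IH => //; apply: ltnW.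
Qed.
End TypeA.

(** * Local relations between involutions *)

Section Involutions.
Variable Q : groupType.
Implicit Types a b c d y : Q.
Local Open Scope group_scope.

Lemma vk_commE a b : vk_comm a b = 1 -> a * b = b * a.
Proof. by rewrite /vk_comm => /divg1_eq ab; rewrite -{2}ab mulgVK. Qed.

Lemma vk_braidE a b : vk_braid a b = 1 -> a * b * a = b * a * b.
Proof.
rewrite /vk_braid => /divg1_eq ab.
by rewrite -{2}ab !mulgVK.
Qed.

Lemma involg a : a^-1 = a -> a * a = 1.
Proof. by move=> {2}<-; rewrite mulgV. Qed.

Lemma involK a y : a^-1 = a -> y * a * a = y.
Proof. by move=> /involg aa; rewrite -mulgA aa mulg1. Qed.

(** The product (aba)(ab'a) is bb' because [a] commutes with bb'; the braid relations turn it into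
    (bab)(b'ab'), which collapses to 1. *)
Lemma braid_unique a b b' : a^-1 = a -> b^-1 = b -> b'^-1 = b' ->
  a * b * a = b * a * b -> a * b' * a = b' * a * b' ->
  a * (b * b') = b * b' * a -> b = b'.
Proof.
move=> ia ib ib' ab ab' abb'.
have abb'K y : y * a * b * b' = y * b * b' * a by rewrite -!mulgA abb' !mulgA.
have e : a * b * a * (a * b' * a) = b * b'.
  by rewrite !mulgA involK// -(mulgA a) abb' involK.
have /mulg1_eq <- : b * b' = 1; last by rewrite ib.
by rewrite -e ab ab' !mulgA abb'K !involK// ?involg.
Qed.

Variables x x' : nat -> Q.
Hypothesis x_invol : forall k, (x k)^-1 = x k.
Hypothesis x'_invol : forall k, (x' k)^-1 = x' k.

(** In the first two of the last four relators the right sides now agree, and the left sides are the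
    same conjugate of b and of b'. *)
Lemma rel4_unprime_b i j k l : all (pred1 1) (vk_rel4 x x' i j k l) ->
  x' k = x k -> x' j = x j.
Proof.
move=> /= /and5P[_ _ _ _ /and5P[_ _ _ _ /and5P[_ _ _ _ /and5P[_ _ _ _]]]].
move=> /and5P[/eqP/divg1_eq e1 /eqP/divg1_eq e2 _ _ _] ck.
by rewrite ck in e1 e2; move: e2; rewrite mulgK -e1 => /mulIg/mulIg/mulIg/mulgI.
Qed.

(** Comparing the first and third of the last four relators, c commutes with d'd, so [braid_unique]
    applies to d and dd'd. *)
Lemma rel4_unprime_d i j k l : all (pred1 1) (vk_rel4 x x' i j k l) ->
  x' i = x i -> x' k = x k -> x' l = x l.
Proof.
move=> rel ai ck; have bj := rel4_unprime_b rel ck.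
move: rel => /= /and5P[_ _ _ /eqP/vk_braidE cd /and5P[_ _ _ _]].
move=> /and5P[_ _ _ /eqP/vk_braidE cd' /and5P[_ _ _ _]].
move=> /and5P[/eqP/divg1_eq e1 _ /eqP/divg1_eq e3 _ _].
move: e3 cd'; rewrite ai in e1 *.
rewrite e1 {e1} ck !x_invol !x'_invol => e cd'.
have d'd : x k * (x' l * x l) = x' l * x l * x k.
  apply: (mulgI (x l)); apply: (mulIg (x l)).
  have := congr1 (fun y => y * (x l * x' l)) e.
  by rewrite !mulgA !involK.
have idd' : (x l * x' l * x l)^-1 = x l * x' l * x l.
  by rewrite !invgM x_invol x'_invol mulgA.
have dd'd : x l = x l * x' l * x l.
  apply: braid_unique idd' cd cd' _ => //.
  by rewrite !mulgA involK// involg// mul1g -mulgA d'd.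
by apply: (mulgI (x l)); rewrite -[LHS](involK _ (x_invol l)) -dd'd.
Qed.

(** The same two relators give aba = a'ba', that is bab = ba'b by the braid relations. *)
Lemma rel4_unprime_a i j k l : all (pred1 1) (vk_rel4 x x' i j k l) ->
  x' k = x k -> x' l = x l -> x' i = x i.
Proof.
move=> rel ck dl; have bj := rel4_unprime_b rel ck.
move: rel => /= /and5P[/eqP/vk_braidE a'b _ _ _ /and5P[_ _ _ _]].
move=> /and5P[/eqP/vk_braidE ab _ _ _ /and5P[_ _ _ _]].
move=> /and5P[/eqP/divg1_eq e1 _ /eqP/divg1_eq e3 _ _].
move: e3; rewrite bj ck dl !x_invol !x'_invol in ab a'b e1 *.
rewrite !(involK _ (x_invol l)) -e1 => /mulIg/mulIg.
rewrite -!mulgA => /mulgI/mulgI; rewrite !mulgA ab a'b.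
by move=> /mulIg/mulgI.
Qed.

(** The fourth relator now says that a commutes with b'b. *)
Lemma rel3_unprime_b i j k : all (pred1 1) (vk_rel3 x x' i j k) ->
  x' i = x i -> x' j = x j.
Proof.
move=> /= /and5P[/eqP/vk_braidE ab /eqP/vk_braidE ab' _ /eqP/divg1_eq e _] ai.
rewrite ai in ab ab' e; apply: braid_unique ab' ab _ => //.
by apply/esym; rewrite {2}e !mulgA !mulgVK.
Qed.

(** Everything follows from aba = dcd: it can be solved for b, and since a and d commute, aca and
    cac both equal dbd. *)
Lemma rel4_cox i j k l : all (pred1 1) (vk_rel4 x x i j k l) ->
  [/\ x k * x l * x k = x l * x k * x l, x i * x l = x l * x i,
      x i * x k * x i = x k * x i * x k &
      x j = x i * x l * x k * x l * x i].
Proof.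
move=> /= /and5P[/eqP/vk_braidE ab _ _ /eqP/vk_braidE cd /and5P[_ _]].
move=> /eqP/vk_commE ad _ /and5P[_ _ _ _ /and5P[_ _ _ _]].
move=> /andP[/eqP/divg1_eq e _].
move: (x_invol i) (x_invol j) (x_invol k) (x_invol l) ab cd ad e.
move: (x i) (x j) (x k) (x l) => a b c d ia ib ic id ab cd.
rewrite ia ib id involg// mul1g !involK// => ad e.
have adK y : y * a * d = y * d * a by rewrite -!mulgA ad.
have eb : b = a * d * c * d * a.
  rewrite (_ : a * d * c * d * a = a * (d * c * d) * a); last by rewrite !mulgA.
  by rewrite -e !mulgA involg// mul1g involK.
have ec : c = d * a * b * a * d.
  rewrite (_ : d * a * b * a * d = d * (a * b * a) * d); last by rewrite !mulgA.
  by rewrite e !mulgA involg// mul1g involK.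
have abK y : y * a * b * a * b = y * b * a.
  by rewrite -2!(mulgA y) ab !mulgA involK.
split=> //.
by rewrite ec !mulgA ad !adK !involK// abK adK involK.
Qed.

(** The relators give a braid relation between c and aba; conjugation by a, which commutes with c,
    turns it into one between c and b. *)
Lemma rel3_cox i j k : all (pred1 1) (vk_rel3 x x i j k) ->
  [/\ x i * x j * x i = x j * x i * x j, x j * x k * x j = x k * x j * x k &
      x i * x k = x k * x i].
Proof.
move=> /= /and5P[/eqP/vk_braidE ab _ _ _ /and5P[/eqP/vk_braidE cb _ _ _]].
move=> /andP[/eqP/vk_commE ac _].
move: (x_invol i) (x_invol j) (x_invol k) ab cb ac.
move: (x i) (x j) (x k) => a b c ia ib ic ab.
rewrite ia ib involg// mul1g !involK// => cb ac.
have acK y : y * a * c = y * c * a by rewrite -!mulgA ac.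
split=> //; apply: (mulgI a); apply: (mulIg a).
by move: cb; rewrite !mulgA -ac !acK !involK.
Qed.

(** * The relators of the complex X^1 *)

Hypothesis rels : all (pred1 1) (vk_relators x x').

Lemma relators1_all :
  [/\ all (pred1 1) (vk_rel4 x x' 1 2 3 4),
      all (pred1 1) (vk_rel4 x x' 6 7 8 9),
      all (pred1 1) (vk_rel3 x x' 4 5 6),
      {in [:: 1; 3; 8; 9]%N, forall i, x' i = x i} &
      {in disjoint_pairs, forall e, x e.1 * x e.2 = x e.2 * x e.1}].
Proof.
move: rels; rewrite /vk_relators 6!all_cat.
move=> /and5P[r1 r2 _ r3 /and3P[r4 r5 _]].
split=> // [i im|e em].
  by move: r4; rewrite all_map => /allP/(_ _ im)/eqP/divg1_eq.
apply/vk_commE/eqP; move/allP: r5; apply.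
by apply/flattenP; exists (vk_rel5 x x' e); rewrite ?map_f// !inE eqxx.
Qed.

(** The order matters: from edges 1, 3, 8, 9, the relations at V_1 give 4 and 2, those at V_4 then
    give 5, and those at V_2 give 6 and 7. *)
Lemma unprime : {in iota 1 9, forall i, x' i = x i}.
Proof.
have [r1 r2 r3 r4 _] := relators1_all.
have [e1 e3 e8 e9] : [/\ x' 1 = x 1, x' 3 = x 3, x' 8 = x 8 & x' 9 = x 9]%N.
  by split; apply: r4.
have e4 := rel4_unprime_d r1 e1 e3.
move=> i; rewrite !inE => /or4P[|||/or4P[|||/or3P[]]] /eqP-> //.
- exact: rel4_unprime_b r1 e3.
- exact: rel3_unprime_b r3 e4.
- exact: rel4_unprime_a r2 e8 e9.
- exact: rel4_unprime_b r2 e8.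
Qed.

(* In the dual graph of the complex, where edge k joins the two triangles that
   share it, these edges form a Hamiltonian path; edges 2 and 7 close the two
   4-cycles around V_1 and V_2. *)
Definition path1 := [:: 1; 3; 4; 5; 6; 8; 9]%N.
Definition path_gen i := x (nth 0%N path1 i).

Lemma path_cox :
  [/\ forall i j, (i.+1 < j < 7)%N ->
        path_gen i * path_gen j = path_gen j * path_gen i,
      forall i, (i.+1 < 7)%N ->
        path_gen i * path_gen i.+1 * path_gen i =
        path_gen i.+1 * path_gen i * path_gen i.+1,
      x 2 = x 1 * x 4 * x 3 * x 4 * x 1 &
      x 7 = x 6 * x 9 * x 8 * x 9 * x 6].
Proof.
have [r1 r2 r3 _ r5] := relators1_all.
have u i : (0 < i < 10)%N -> x' i = x i.
  by move=> i10; apply: unprime; rewrite mem_iota.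
rewrite /vk_rel4 /vk_rel3 !u// in r1 r2 r3.
have [b34 c14 b13 e2] := rel4_cox r1.
have [b89 c69 b68 e7] := rel4_cox r2.
have [b45 b56 c46] := rel3_cox r3.
split=> //.
(* Pairs with a common vertex, namely 1 and 4, 4 and 6, 6 and 9, commute by the vertex relations;
   the other pairs by (R5). *)
- case=> [|[|[|[|[|[|i]]]]]] [|[|[|[|[|[|[|j]]]]]]] //=;
    rewrite ?andbF// => _; rewrite /path_gen /=; exact: (r5 (_, _)).
- by case=> [|[|[|[|[|[|i]]]]]].
Qed.

Lemma parabolic_gen k y : k \in iota 1 9 ->
  parabolic path_gen 7 y -> parabolic path_gen 7 (y * x k).
Proof.
have [comm braid e2 e7] := path_cox => k9 py.
have step i z : (i < 7)%N -> parabolic path_gen 7 z ->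
    parabolic path_gen 7 (z * path_gen i).
  by apply: (parabolicM _ comm braid) => // j _; exact/involg/x_invol.
move: k9; rewrite !inE => /or4P[|||/or4P[|||/or3P[]]] /eqP->.
- exact: (step 0%N).
- rewrite e2 !mulgA.
  exact/(step 0%N)/(step 2%N)/(step 1%N)/(step 2%N)/(step 0%N).
- exact: (step 1%N).
- exact: (step 2%N).
- exact: (step 3%N).
- exact: (step 4%N).
- rewrite e7 !mulgA.
  exact/(step 4%N)/(step 6%N)/(step 5%N)/(step 6%N)/(step 4%N).
- exact: (step 5%N).
- exact: (step 6%N).
Qed.
End Involutions.

(** * Relators under homomorphisms, quotients and free groups *)

Lemma map_vk_relators (G H : groupType) (f : {multiplicative G -> H})
    (x x' : nat -> G) :
  map f (vk_relators x x') = vk_relators (f \o x) (f \o x').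
Proof.
pose fE := (@gmulfM _ _ f, multiplicativeV f, multiplicative1 f).
rewrite /vk_relators 6!map_cat.
congr (_ ++ (_ ++ (_ ++ (_ ++ (_ ++ (_ ++ _)))))).
- by rewrite /= /vk_braid /vk_comm /vk_eq !fE.
- by rewrite /= /vk_braid /vk_comm /vk_eq !fE.
- by rewrite /= /vk_braid /vk_comm /vk_eq !fE.
- by rewrite /= /vk_braid /vk_comm /vk_eq !fE.
- by rewrite /= /vk_eq !fE.
- rewrite map_flatten -map_comp; congr flatten; apply: eq_map => e /=.
  by rewrite /vk_rel5 /= /vk_comm !fE.
- by rewrite /= !big_cons !big_nil !fE.
Qed.
Section Presentations.
Local Open Scope group_scope.

Lemma quot_projM (G : groupType) (K : set G) :
  {morph @quot_proj G K : y z / y * z}.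
Proof. by move=> y z; rewrite /quot_proj -pclsM. Qed.

HB.instance Definition _ (G : groupType) (K : set G) :=
  isMultiplicative.Build G (quot_group K) (@quot_proj G K) (@quot_projM G K).

Lemma quot_proj_rel (G : groupType) (K : set G) r : K r -> quot_proj K r = 1.
Proof.
move=> Kr; rewrite -(multiplicative1 (@quot_proj G K)).
apply/(@pclsP (coset_pregroup K) r 1); apply: (@coset_eq_sym G K 1 r).
rewrite /coset_eq invg1 mul1g.
by move=> H [_]; apply.
Qed.

Lemma quot_proj_surj (G : groupType) (K : set G) q :
  exists y, quot_proj K y = q.
Proof. by exists (prep q); exact: prepK. Qed.

(** Letters are split off at the right end, to match the closure of normal forms under right
    multiplication. *)
Lemma free_group_ind (I : Type) (P : free_group I -> Prop) : P 1 ->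
  (forall w i, P w -> P (w * free_gen i)) ->
  (forall w i, P w -> P (w * (free_gen i)^-1)) -> forall w, P w.
Proof.
move=> P1 PM PV w; rewrite -(prepK w).
elim/last_ind: (prep w) => {w} [//|w [i b] Pw].
have -> : pcls (rcons w (i, b) : free_pregroup I) =
    pcls (w : free_pregroup I) * pcls ([:: (i, b)] : free_pregroup I).
  by rewrite -pclsM -cats1.
case: b; last exact: PM.
have -> : pcls ([:: (i, true)] : free_pregroup I) = (free_gen i)^-1.
  by rewrite -pclsV.
exact: PV.
Qed.
End Presentations.

(** * Triviality of the kernel *)

Theorem theorem3p1 (R : realType) (N : nat)
    (* X in CP^N and the generic projection X -> CP^2 of matrix A *)
    (X : set (CP R N)) (A : 'M[Cx R]_(N.+1, 3))
    (X_surface : projective_surface X)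
    (X_degree : surface_degree X 8)
    (X_degenerates : degenerates_to_shadow X triangle1)
    (A_generic : generic_projection X A)
    (* the presentation of G = pi_1(CP^2 - S) on gamma_i, gamma_i' *)
    (x0 : ~` branch_curve X A)
    (gamma : vk_index -> pi1 R x0)
    (G_presentation : presented_by gamma relators1)
    (* 1 -> pi_1(X_Gal) -> G / <<gamma^2>> -> S_8 -> 1 *)
    (y0 : galois_cover X A 8)
    (iota : {multiplicative pi1 R y0 -> quot_group (squares gamma)})
    (rho : {multiplicative quot_group (squares gamma) -> 'S_8})
    (rho_gamma : transposition_rule
       (fun i => quot_proj (squares gamma) (gamma i)) rho)
    (exact_sequence : short_exact iota rho) :
  forall a : pi1 R y0, a = 1%g.
Proof.
have [iota_inj kerE _] := exact_sequence.
case: G_presentation => phi [[psi phiK psiK] phi_gen].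
pose f : {multiplicative free_group vk_index -> quot_group (squares gamma)} :=
  @quot_proj _ (squares gamma) \o (phi \o @quot_proj _ relators1).
(* Outside 1..9, [inord] still returns some index, so [x k] and [x' k] are involutions for every
   [k]. *)
pose x k := f (free_gen (inord k.-1 : 'I_9, false)).
pose x' k := f (free_gen (inord k.-1 : 'I_9, true)).
have f_gen i : f (free_gen i) = quot_proj (squares gamma) (gamma i).
  by rewrite /f /= phi_gen.
have f_invol i : (f (free_gen i))^-1%g = f (free_gen i).
  apply: mulg1_eq; rewrite f_gen -quot_projM.
  by apply: quot_proj_rel; exists i.
have x_invol k : (x k)^-1%g = x k by apply: f_invol.
have x'_invol k : (x' k)^-1%g = x' k by apply: f_invol.
have rels : all (pred1 1%g) (vk_relators x x').
  rewrite -[vk_relators x x'](map_vk_relators f) all_map; apply/allP => r rr /=.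
  by rewrite /f /= (quot_proj_rel (rr : relators1 r)) !multiplicative1.
have f_gen1 i : exists2 k, k \in seq.iota 1 9 & f (free_gen i) = x k.
  case: i => i b; exists i.+1; first by rewrite mem_iota /= ltnS.
  case: b; last by rewrite /x succnK inord_val.
  have <- : x' i.+1 = x i.+1.
    by apply: (unprime x_invol x'_invol rels); rewrite mem_iota /= ltnS.
  by rewrite /x' succnK inord_val.
have nf q : parabolic (path_gen x) 7 q.
  have [g <-] := quot_proj_surj q; rewrite -(psiK g).
  have [w <-] := quot_proj_surj (psi g).
  rewrite -[quot_proj _ _]/(f w).
  elim/free_group_ind: w => [|w i pw|w i pw].
  - by rewrite multiplicative1; exact: parabolic1.
  - rewrite gmulfM; have [k k9 ->] := f_gen1 i.
    exact: (parabolic_gen x_invol x'_invol rels k9).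
  - rewrite gmulfM multiplicativeV f_invol; have [k k9 ->] := f_gen1 i.
    exact: (parabolic_gen x_invol x'_invol rels k9).
(* The triangles met along [path1]. *)
pose p i : 'I_8 := inord (nth 0%N [:: 0; 3; 2; 1; 4; 7; 6; 5]%N i).
have p8 i : (i <= 7)%N -> (nth 0%N [:: 0; 3; 2; 1; 4; 7; 6; 5] i < 8)%N.
  by case: i => [|[|[|[|[|[|[|[]]]]]]]].
have p_inj i j : (i <= 7)%N -> (j <= 7)%N -> p i = p j -> i = j.
  move=> i7 j7 /(congr1 (@nat_of_ord 8)); rewrite /p !inordK ?p8//.
  by move/eqP; rewrite nth_uniq// => /eqP.
have rho_s i : (i < 7)%N -> rho (path_gen x i) = tperm (p i) (p i.+1).
  move=> i7; rewrite /path_gen /x f_gen; apply: rho_gamma.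
  - apply/eqP => /(p_inj _ _ (ltnW i7) i7)/eqP.
    by rewrite (ltn_eqF (ltnSn i)).
  - apply/allP; rewrite /edge1 /triangle1 /p !inordK ?p8 ?(ltnW i7)//;
      by case: i i7 => [|[|[|[|[|[|[]]]]]]].
  - apply/allP; rewrite /edge1 /triangle1 /p !inordK ?p8//;
      by case: i i7 => [|[|[|[|[|[|[]]]]]]].
(* By exactness [iota a] lies in the kernel of [rho], which normal forms show to be trivial. *)
move=> a; apply: iota_inj; rewrite multiplicative1.
apply: (parabolic_inj p_inj rho_s (leqnn 7) (nf _)).
by apply/kerE; exists a.
Qed.
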